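(* Let $n$ be a positive integer, let $\mathbb{Z}_n$ be the ring of integers modulo $n$, and let $G_N(\mathbb{Z}_n)$ be its nil clean graph. Then: (1) If $n=2^k$ for some integer $k\geq 1$, then $\operatorname{diam}(G_N(\mathbb{Z}_n))=1$. (2) If $n=2^k3^l$ for some integers $k\geq 0$ and $l\geq 1$, then $\operatorname{diam}(G_N(\mathbb{Z}_n))=2$. (3) For a prime $p$, $\operatorname{diam}(G_N(\mathbb{Z}_p))=p-1$. (4) If $n=2p$ where $p$ is an odd prime, then $\operatorname{diam}(G_N(\mathbb{Z}_{2p}))=p-1$. (5) If $n=3p$ where $p$ is an odd prime, then $\operatorname{diam}(G_N(\mathbb{Z}_{3p}))=p-1$.
   Context: An element $r$ of a ring $R$ is nil clean if $r=m+e$ for some nilpotent $m\in R$ and some idempotent $e\in R$. The nil clean graph $G_N(R)$ is the simple undirected graph (no loops) with vertex set $R$ in which two distinct vertices $x,y$ are adjacent if and only if $x+y$ is a nil clean element of $R$. The distance $d(x,y)$ is the number of edges on a shortest path between $x$ and $y$ ($\infty$ if there is none), and the diameter is the maximum of $d(x,y)$ over pairs of distinct vertices. *)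

(* Defs.v *)
From HB Require Import structures.
From mathcomp Require Import all_boot all_algebra.
From mathcomp Require Import boolp.

Set Implicit Arguments.
Unset Strict Implicit.
Unset Printing Implicit Defensive.

Import GRing.Theory.

Record sgraph := SGraph {
  vertex :> eqType;
  adj : rel vertex;
  adj_sym : symmetric adj;
  adj_irrefl : irreflexive adj
}.

(* A path from x is given by the sequence p of its vertices other than x, so   *)
(* that its number of edges is size p.                                        *)
Definition path_between (G : sgraph) (x y : G) (p : seq G) : Prop :=
  [/\ path (@adj G) x p, last x p = y & uniq (x :: p)].

(* Distances and diameters lie in the extended natural numbers [option nat],  *)
(* where None is the infinite value.                                          *)
Definition le_ext (d e : option nat) : bool :=
  match d, e with
  | _, None => true
  | Some m, Some n => m <= n
  | None, Some _ => false
  end.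

Definition is_dist (G : sgraph) (x y : G) (d : option nat) : Prop :=
  match d with
  | Some k => (exists2 p, path_between x y p & size p = k) /\
              (forall p, path_between x y p -> k <= size p)
  | None => forall p, ~ path_between x y p
  end.

Definition is_diam (G : sgraph) (d : option nat) : Prop :=
  (exists x y : G, x <> y /\ is_dist x y d) /\
  (forall (x y : G) (e : option nat), x <> y -> is_dist x y e -> le_ext e d).

Lemma is_dist_uniq (G : sgraph) (x y : G) (d e : option nat) :
  is_dist x y d -> is_dist x y e -> d = e.
Proof.
case: d e => [k|] [l|] //=.
- move=> [[p Hp <-] Hk] [[q Hq <-] Hl]; congr Some; apply/eqP.
  by rewrite eqn_leq Hk // Hl.
- by move=> [[p Hp _] _] /(_ p).
- by move=> H [[p Hp _] _]; case: (H p).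
Qed.

Lemma is_dist_ex (G : sgraph) (x y : G) : exists d, is_dist x y d.
Proof.
pose P k := `[< exists2 p, path_between x y p & size p = k >].
have [exP|nP] := pselect (exists k, P k); last first.
  by exists None => p Hp; apply: nP; exists (size p); apply/asboolP; exists p.
case: (ex_minnP exP) => k /asboolP Hk min_k; exists (Some k); split=> // p Hp.
by apply: min_k; apply/asboolP; exists p.
Qed.

Lemma is_diam_uniq (G : sgraph) (d e : option nat) :
  is_diam G d -> is_diam G e -> d = e.
Proof.
move=> [[x [y [xy dxy]]] Hd] [[z [t [zt dzt]]] He].
move: (He _ _ _ xy dxy) (Hd _ _ _ zt dzt).
by case: d e {Hd He dxy dzt} => [k|] [l|] //= kl lk;
  congr Some; apply/eqP; rewrite eqn_leq kl.
Qed.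

Section NilClean.
Local Open Scope ring_scope.

Definition nilpotent_elt (R : pzRingType) (m : R) : Prop :=
  exists2 k : nat, (0 < k)%N & m ^+ k = 0.

Definition idempotent_elt (R : pzRingType) (e : R) : Prop := e * e = e.

Definition nil_clean (R : pzRingType) (r : R) : Prop :=
  exists m e : R, [/\ nilpotent_elt m, idempotent_elt e & r = m + e].

Definition nil_clean_adj (R : pzRingType) : rel R :=
  fun x y => (x != y) && `[< nil_clean (x + y) >].

Lemma nil_clean_adj_sym (R : pzRingType) : symmetric (@nil_clean_adj R).
Proof. by move=> x y; rewrite /nil_clean_adj eq_sym addrC. Qed.

Lemma nil_clean_adj_irrefl (R : pzRingType) : irreflexive (@nil_clean_adj R).
Proof. by move=> x; rewrite /nil_clean_adj eqxx. Qed.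

Definition nil_clean_graph (R : pzRingType) : sgraph :=
  SGraph (@nil_clean_adj_sym R) (@nil_clean_adj_irrefl R).

End NilClean.

(* Main.v *)
Require Import Defs.
From mathcomp Require Import all_boot all_algebra.
From mathcomp Require Import all_order boolp zify ring.
Import Order.TTheory GRing.Theory Num.Theory.

(* Call a walk a sequence whose consecutive sums are nil clean, repetitions
   allowed; shortening makes it a path of the graph, so the diameter can be
   computed with walks. Two steps x, b - x, x + (a - b) with a and b nil clean
   add a - b to x. If every integer congruent to 0 or 1 modulo an odd prime p
   (and, when n = 3p, also modulo 3) is nil clean, then any d is a sum of
   (p - 1)/2 such differences, because its centered residue modulo p is at most
   (p - 1)/2 in absolute value; so any two elements are joined by a walk of
   length p - 1. Conversely a walk of length k from 0 reduces modulo p to a walk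
   with sums in {0, 1}, whose end is the class of an integer m with
   -k <= 2m <= k + 1; it cannot be 1/2 unless k >= p - 1, since 2m - 1 would be
   an odd multiple of p. *)

(** * Diameter from walks *)

Section Walks.

Lemma walk_path_between (R : pzRingType) (x y : R) (s : seq R) :
  path (fun u v => `[< nil_clean (u + v)%R >]) x s -> last x s = y ->
  exists2 s', @path_between (nil_clean_graph R) x y s' & size s' <= size s.
Proof.
move=> xs <-; case/shortenP: xs => s' xs' us' ss'.
exists s'; last by apply: uniq_leq_size ss'; case/andP: us'.
split=> //.
elim: s' x {ss'} us' xs' => //= z s' IH x /andP[xzs' us'] /andP[xz zs'].
rewrite IH // andbT /nil_clean_adj xz andbT.
by apply: contraNneq xzs' => ->; rewrite mem_head.
Qed.

(** Walks suffice for both bounds: a walk shortens to a path that is no longer, and every path is a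
    walk. The pair [x0], [y0] attains the maximum. *)
Lemma is_diam_of_walks (R : pzRingType) (D : nat) (x0 y0 : R) :
  (forall x y : R, x <> y -> exists s, [/\ last x s = y, size s <= D &
     path (fun u v => `[< nil_clean (u + v)%R >]) x s]) ->
  x0 <> y0 ->
  (forall s, path (fun u v => `[< nil_clean (u + v)%R >]) x0 s ->
     last x0 s = y0 -> D <= size s) ->
  is_diam (nil_clean_graph R) (Some D).
Proof.
move=> ub xy0 lb.
have short x y : x <> y ->
    exists2 s, @path_between (nil_clean_graph R) x y s & size s <= D.
  move=> /ub[s [ls sD xs]]; have [s' ps' ss'] := walk_path_between R x y s xs ls.
  by exists s' => //; apply: leq_trans sD.
have low s : @path_between (nil_clean_graph R) x0 y0 s -> D <= size s.
  by case=> xs ls _; apply: lb ls; apply: sub_path xs => u v /andP[].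
split.
  exists x0, y0; split=> //; split=> //.
  have [s ps sD] := short _ _ xy0; exists s => //.
  by apply/eqP; rewrite eqn_leq sD low.
move=> x y [k|] xy; last by have [s ps _] := short _ _ xy; move=> /(_ s).
by move=> [_ kmin]; have [s ps sD] := short _ _ xy; apply: leq_trans (kmin s ps) sD.
Qed.

End Walks.

(** * Nil clean residues modulo n *)

Section IntegersModulo.
Local Open Scope ring_scope.

Lemma intr_Zp_eq0 (n : nat) (z : int) :
  (1 < n)%N -> ((z%:~R : 'Z_n) == 0) = (n %| z)%Z.
Proof.
move=> n_gt1; have natE (m : nat) : ((m%:R : 'Z_n) == 0) = (n %| m)%N.
  by rewrite -val_eqE /= val_Zp_nat.
case: z => m; first by rewrite -pmulrn natE.
by rewrite NegzE mulrNz oppr_eq0 -pmulrn natE dvdzE abszN.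
Qed.

Lemma intr_Zp_surj (n : nat) (x : 'Z_n) : exists z : int, x = z%:~R.
Proof. by exists (x : nat); rewrite -pmulrn natr_Zp. Qed.

(** The Chinese remainder theorem gives c congruent to e modulo a and to f modulo b. Then c is
    idempotent, and r - c is nilpotent because it is so modulo each factor. *)
Lemma nil_clean_Zn_coprime (a b : nat) (r : int) (e f : bool) (j k : nat) :
  (1 < a * b)%N -> coprime a b ->
  (a %| (r - e%:R) ^+ j)%Z -> (b %| (r - f%:R) ^+ k)%Z ->
  nil_clean (r%:~R : 'Z_(a * b)).
Proof.
move=> ab_gt1 cab ha hb.
have dvd_ab z : (a %| z)%Z -> (b %| z)%Z -> ((a * b)%N %| z)%Z.
  by move=> az bz; rewrite PoszM Gauss_dvdz ?az ?bz // coprimezE.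
pose c := zchinese a b e%:R f%:R.
have cabz : coprimez a b by rewrite coprimezE.
have ca : (a %| c - e%:R)%Z by rewrite -eqz_mod_dvd zchinese_modl.
have cb : (b %| c - f%:R)%Z by rewrite -eqz_mod_dvd zchinese_modr.
have pow (q : nat) (g : bool) i : (q %| c - g%:R)%Z ->
    (q %| (r - g%:R) ^+ i)%Z -> (q %| (r - c) ^+ i)%Z.
  move=> qc; have -> : r - c = (r - g%:R) - (c - g%:R) by ring.
  move: (r - _) => u hu; rewrite -[_ ^+ _](subrK (u ^+ i)) rpredD //.
  by rewrite subrXX dvdz_mulr // addrAC subrr sub0r rpredN.
exists (r - c)%:~R, c%:~R; split; last by rewrite -rmorphD subrK.
  (* The successor keeps the exponent positive when j = k = 0. *)
  exists (j + k).+1 => //; apply/eqP; rewrite -rmorphXn intr_Zp_eq0 //.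
  rewrite exprS exprD dvdz_mull //; apply: dvd_ab.
    by rewrite dvdz_mulr // (pow _ e).
  by rewrite dvdz_mull // (pow _ f).
apply/eqP; rewrite -subr_eq0 -rmorphM -rmorphB intr_Zp_eq0 //.
have idem (q : nat) (g : bool) : (q %| c - g%:R)%Z -> (q %| c * c - c)%Z.
  have -> : c * c - c = c * (c - 1) by ring.
  by case: g => /= h; [apply: dvdz_mull | apply: dvdz_mulr; rewrite subr0 in h].
by apply: dvd_ab; [apply: idem ca | apply: idem cb].
Qed.

Lemma dvdz_exp_nat (c j : nat) (z : int) :
  (c %| z)%Z -> ((c ^ j)%N %| z ^+ j)%Z.
Proof. by move=> cz; rewrite !dvdzE abszX dvdn_exp2r. Qed.

Lemma nil_clean_Zn_pow (c d i j : nat) (r : int) (e f : bool) :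
  (1 < c ^ i * d ^ j)%N -> coprime c d ->
  (c %| r - e%:R)%Z -> (d %| r - f%:R)%Z ->
  nil_clean (r%:~R : 'Z_(c ^ i * d ^ j)).
Proof.
move=> n_gt1 cd hc hd; apply: (nil_clean_Zn_coprime _ _ r e f i j) => //.
- by rewrite coprimeXl // coprimeXr.
- exact: dvdz_exp_nat.
- exact: dvdz_exp_nat.
Qed.

(** * Upper bound: construction of walks *)

Lemma centered_residue (q : nat) (d : int) : odd q ->
  exists2 u : int, `|u| <= q./2%:Z & (q %| d - u)%Z.
Proof.
move=> oq; have q_gt0 : (0 < q)%N by case: q oq.
have qE : q = (q./2.*2).+1 by rewrite -[LHS]odd_double_half oq.
have r_ge0 : 0 <= (d %% q)%Z by apply: modz_ge0; lia.
have r_lt : (d %% q)%Z < q%:Z by apply: ltz_pmod; lia.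
have dr : (q %| d - (d %% q)%Z)%Z by rewrite -eqz_mod_dvd modz_mod.
move: (d %% q)%Z r_ge0 r_lt dr => r r_ge0 r_lt dr.
have [rs|rb] := leP r q./2%:Z; first by exists r => //; lia.
exists (r - q%:Z); first by lia.
have -> : d - (r - q%:Z) = (d - r) + q%:Z by ring.
by rewrite rpredD ?dvdzz.
Qed.

(** Taking a - b to be the sign of u moves u one unit towards 0. *)
Lemma split_bounded (t : nat) (u : int) : `|u| <= t.+1%:Z ->
  exists a b : bool, `|u - a%:R + b%:R| <= t%:Z.
Proof.
move=> ut; have [u0|[u0|u0]] : u = 0 \/ 0 < u \/ u < 0 by lia.
- by exists false, false; rewrite u0.
- by exists true, false => /=; lia.
- by exists false, true => /=; lia.
Qed.

(** The numbers u and v track what remains to be added modulo p and modulo q. Since a and b can be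
    prescribed in {0, 1} modulo p and q independently, each pair of steps brings both u and v closer
    to 0. *)
Lemma walk_Zn (n p q : nat) : coprime p q ->
  (forall (r : int) (e f : bool), (p %| r - e%:R)%Z -> (q %| r - f%:R)%Z ->
     nil_clean (r%:~R : 'Z_n)) ->
  forall (t : nat) (x d u v : int),
  `|u| <= t.+1%:Z -> `|v| <= t.+1%:Z -> (p %| d - u)%Z -> (q %| d - v)%Z ->
  exists s : seq 'Z_n, [/\ last x%:~R s = (x + d)%:~R, size s = (t.+1).*2 &
    path (fun y z => `[< nil_clean (y + z) >]) x%:~R s].
Proof.
move=> cpq nc.
have step (x a b : int) (e f g h : bool) :
    (p %| a - e%:R)%Z -> (q %| a - f%:R)%Z ->
    (p %| b - g%:R)%Z -> (q %| b - h%:R)%Z ->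
    path (fun y z : 'Z_n => `[< nil_clean (y + z) >]) x%:~R
      [:: (b - x)%:~R; (x + (a - b))%:~R].
  move=> pa qa pb qb; rewrite /= andbT; apply/andP; split; apply/asboolP.
    by rewrite -rmorphD (_ : x + (b - x) = b); [apply: nc pb qb | ring].
  rewrite -rmorphD (_ : b - x + (x + (a - b)) = a); last by ring.
  exact: nc pa qa.
have cpqz : coprimez p q by rewrite coprimezE.
have crt (e f : bool) :
    exists a : int, (p %| a - e%:R)%Z /\ (q %| a - f%:R)%Z.
  exists (zchinese p q e%:R f%:R).
  by rewrite -!eqz_mod_dvd zchinese_modl // zchinese_modr.
elim=> [|t IH] x d u v ut vt pu qv.
  have [e [g peg]] := split_bounded _ _ ut.
  have [f [h qfh]] := split_bounded _ _ vt.
  have [b [pb qb]] := crt g h.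
  (* the last step absorbs the exact value of d, not only its residues *)
  exists [:: (b - x)%:~R; (x + ((b + d) - b))%:~R]; split=> //.
    by rewrite /= [b + d]addrC addrK.
  apply: (step x (b + d) b e f g h) => //.
    have -> : b + d - e%:R = (b - g%:R) + (d - u) + (u - e%:R + g%:R) by ring.
    have -> : u - e%:R + g%:R = 0 by apply/eqP; rewrite -normr_le0.
    by rewrite addr0 rpredD.
  have -> : b + d - f%:R = (b - h%:R) + (d - v) + (v - f%:R + h%:R) by ring.
  have -> : v - f%:R + h%:R = 0 by apply/eqP; rewrite -normr_le0.
  by rewrite addr0 rpredD.
have [e [g peg]] := split_bounded _ _ ut.
have [f [h qfh]] := split_bounded _ _ vt.
have [a [pa qa]] := crt e f; have [b [pb qb]] := crt g h.
have [||s [ls ss xs]] := IH (x + (a - b)) (d - (a - b)) _ _ peg qfh.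
- have -> : d - (a - b) - (u - e%:R + g%:R) =
            (d - u) - (a - e%:R) + (b - g%:R) by ring.
  by rewrite rpredD // rpredB.
- have -> : d - (a - b) - (v - f%:R + h%:R) =
            (d - v) - (a - f%:R) + (b - h%:R) by ring.
  by rewrite rpredD // rpredB.
exists ([:: (b - x)%:~R; (x + (a - b))%:~R] ++ s); split.
- by rewrite last_cat /= ls; congr (_%:~R); ring.
- by rewrite size_cat ss doubleS.
- by rewrite cat_path (step x a b e f g h).
Qed.

(** * Lower bound: reduction modulo p *)

Lemma natr_Fp_modn (n p m : nat) : prime p -> (p %| n)%N ->
  (m %% n)%:R = m%:R :> 'F_p.
Proof. by move=> p_pr pn; rewrite -Fp_nat_mod // modn_dvdm // Fp_nat_mod. Qed.

Lemma Zn_to_Fp_D (n p : nat) (x y : 'Z_n) : (1 < n)%N -> prime p -> (p %| n)%N ->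
  (((x + y)%R : nat)%:R : 'F_p) = (x : nat)%:R + (y : nat)%:R.
Proof.
move=> n_gt1 p_pr pn; rewrite -natrD -(natr_Fp_modn n p (x + y)%N) //.
(* Addition in ['Z_n] reduces modulo [(Zp_trunc n).+2], which is n only for n > 1. *)
by rewrite -[X in (_ %% X)%N](Zp_cast n_gt1).
Qed.

Lemma Zn_to_Fp_M (n p : nat) (x y : 'Z_n) : (1 < n)%N -> prime p -> (p %| n)%N ->
  (((x * y)%R : nat)%:R : 'F_p) = (x : nat)%:R * (y : nat)%:R.
Proof.
move=> n_gt1 p_pr pn; rewrite -natrM -(natr_Fp_modn n p (x * y)%N) //.
by rewrite -[X in (_ %% X)%N](Zp_cast n_gt1).
Qed.

(** In the field ['F_p] the nilpotent part vanishes and the idempotent part becomes 0 or 1. *)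
Lemma nil_clean_Zn_Fp (n p : nat) (x : 'Z_n) :
  (1 < n)%N -> prime p -> (p %| n)%N -> nil_clean x ->
  exists e : bool, ((x : nat)%:R : 'F_p) = e%:R.
Proof.
move=> n_gt1 p_pr pn [m [i [[k k0 mk0] ii ->]]].
have fM y z := Zn_to_Fp_M n p y z n_gt1 p_pr pn.
have m0 : ((m : nat)%:R : 'F_p) = 0.
  have fX j : (((m ^+ j.+1)%R : nat)%:R : 'F_p) = (m : nat)%:R ^+ j.+1.
    by elim: j => [|j IH]; rewrite ?expr1 // exprS fM IH -exprS.
  apply/eqP; have := fX k.-1; rewrite prednK // mk0 /= => /esym/eqP.
  by rewrite expf_eq0 => /andP[].
rewrite Zn_to_Fp_D // m0 add0r; move/(congr1 (fun z : 'Z_n => (z : nat)%:R : 'F_p)): ii.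
rewrite fM => /eqP; rewrite -subr_eq0 -[X in _ - X]mulr1 -mulrBr mulf_eq0.
by rewrite subr_eq0 => /orP[] /eqP ->; [exists false | exists true].
Qed.

(** If m lifts the current vertex, then e - m lifts the next one for some e in {0, 1}, and -k <= 2m
    <= k + 1 gives -(k + 1) <= 2(e - m) <= k + 2. *)
Lemma walk_from0_Fp (n p : nat) (s : seq 'Z_n) (x : 'Z_n) (m : int) (k : nat) :
  (1 < n)%N -> prime p -> (p %| n)%N ->
  path (fun y z => `[< nil_clean (y + z) >]) x s ->
  (x : nat)%:R = m%:~R :> 'F_p -> - k%:Z <= m *+ 2 <= k.+1%:Z ->
  exists m' : int, ((last x s : nat)%:R = m'%:~R :> 'F_p) /\
    - (k + size s)%N%:Z <= m' *+ 2 <= (k + size s).+1%:Z.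
Proof.
move=> n_gt1 p_pr pn; elim: s x m k => [|y s IH] x m k /=.
  by exists m; rewrite addn0.
move=> /andP[/asboolP/nil_clean_Zn_Fp-/(_ p n_gt1 p_pr pn)[e xye] ys] xm mk.
rewrite addnS -addSn; apply: (IH _ (e%:R - m)) => //.
  rewrite intrB -xm mulrz_nat -xye Zn_to_Fp_D //.
  by rewrite addrC addKr.
by case: e {xye} => /=; lia.
Qed.

(** The second modulus q is 1 when the residue modulo p alone decides, and 3 for n = 3p. As q <= p,
    centered residues modulo q obey the bound (p - 1)/2 too. *)
Lemma diam_nil_clean_Zn (n p q : nat) :
  (1 < n)%N -> prime p -> odd p -> (p %| n)%N ->
  coprime p q -> odd q -> (q <= p)%N ->
  (forall (r : int) (e f : bool), (p %| r - e%:R)%Z -> (q %| r - f%:R)%Z ->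
     nil_clean (r%:~R : 'Z_n)) ->
  is_diam (nil_clean_graph 'Z_n) (Some (p - 1)%N).
Proof.
move=> n_gt1 p_pr op pn cpq oq qp nc.
have p_gt1 := prime_gt1 p_pr.
have pE : p = (p./2.*2).+1 by rewrite -[LHS]odd_double_half op.
(* This is (p + 1)/2, the inverse of 2 modulo p. *)
pose h := (p./2).+1.
have hmod (x : 'Z_n) : x = h%:R -> (x : nat)%:R = h%:R :> 'F_p.
  by move=> ->; rewrite val_Zp_nat // natr_Fp_modn.
have h2 : (h%:R *+ 2 : 'F_p) = 1.
  rewrite -mulrnA (_ : (h * 2)%N = (p + 1)%N); last by rewrite /h; lia.
  by rewrite natrD pchar_Fp_0 // add0r.
apply: (is_diam_of_walks _ _ 0 h%:R).
- move=> x y _; have [z1 ->] := intr_Zp_surj _ x; have [z2 ->] := intr_Zp_surj _ y.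
  have [u up pu] := centered_residue p (z2 - z1) op.
  have [v vq qv] := centered_residue q (z2 - z1) oq.
  have tE : (p./2.-1.+1)%N = p./2 by rewrite prednK // half_gt0.
  have [||s [ls ss xs]] :=
    walk_Zn n p q cpq nc p./2.-1 z1 (z2 - z1) u v _ _ pu qv.
  + by rewrite tE.
  + by rewrite tE; apply: le_trans vq _; rewrite lez_nat half_leq.
  exists s; split=> //; first by rewrite ls addrC subrK.
  by rewrite ss tE [in X in (_ <= X)%N]pE subn1.
- move/hmod => /= h0; move: h2; rewrite -h0 mul0rn => /eqP.
  by rewrite eq_sym oner_eq0.
- move=> s xs ls.
  have [||m [lm mb]] := walk_from0_Fp n p s 0 0 0 n_gt1 p_pr pn xs => //.
  move: lm; rewrite ls hmod // => hm.
  have : (p %| m *+ 2 - 1)%Z.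
    have m2 : (m *+ 2 - 1)%:~R = 0 :> 'F_p.
      by rewrite intrB -[m *+ 2]mulr_natr intrM -hm mulr_natr h2 subrr.
    (* ['F_p] is by definition ['Z_(pdiv p)]. *)
    rewrite -{1}(pdiv_id p_pr) -intr_Zp_eq0; last by rewrite pdiv_id.
    by apply/eqP; exact: m2.
  (* Being odd, 2m - 1 is nonzero, so p <= |2m - 1| <= [size s] + 1. *)
  rewrite dvdzE /= => /dvdn_leq; move: mb; rewrite add0n; clear.
  have : (0 < `|m *+ 2 - 1|)%N by lia.
  by move=> m2 mb /(_ m2); lia.
Qed.

End IntegersModulo.

(* 'Z_n is the ring of integers modulo n only for n > 1, which the hypotheses *)
(* of each of the five clauses imply.                                         *)
Theorem theorem3p12 (n : nat) (n_gt0 : 0 < n) :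
  (forall k : nat, 1 <= k -> n = 2 ^ k ->
     is_diam (nil_clean_graph 'Z_n) (Some 1)) /\
  (forall k l : nat, 1 <= l -> n = 2 ^ k * 3 ^ l ->
     is_diam (nil_clean_graph 'Z_n) (Some 2)) /\
  (forall p : nat, prime p ->
     is_diam (nil_clean_graph 'Z_p) (Some (p - 1))) /\
  (forall p : nat, prime p -> odd p -> n = 2 * p ->
     is_diam (nil_clean_graph 'Z_n) (Some (p - 1))) /\
  (forall p : nat, prime p -> odd p -> n = 3 * p ->
     is_diam (nil_clean_graph 'Z_n) (Some (p - 1))).
Proof.
have case1 k : 1 <= k -> is_diam (nil_clean_graph 'Z_(2 ^ k)) (Some 1).
  (* The trivial factor [1 ^ 0] gives n the two-factor form of [nil_clean_Zn_pow]. *)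
  move=> k_gt0; have n_gt1 : 1 < 2 ^ k * 1 ^ 0.
    by rewrite muln1 -[1](expn0 2) ltn_exp2l.
  have nc (x : 'Z_(2 ^ k * 1 ^ 0)) : nil_clean x.
    have [r ->] := intr_Zp_surj _ x.
    apply: (nil_clean_Zn_pow 2 1 k 0 r (odd `|r|%N) false) => //; lia.
  suff: is_diam (nil_clean_graph 'Z_(2 ^ k * 1 ^ 0)) (Some 1) by rewrite muln1.
  apply: (is_diam_of_walks _ _ 0%R 1%R).
  - by move=> x y _; exists [:: y]; split=> //=; rewrite andbT; apply/asboolP.
  - by apply/eqP; rewrite eq_sym oner_eq0.
  - by case=> //= _ /eqP; rewrite eq_sym oner_eq0.
have case2 k l : 1 <= l -> is_diam (nil_clean_graph 'Z_(2 ^ k * 3 ^ l)) (Some 2).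
  move=> l_gt0; have n_gt1 : 1 < 2 ^ k * 3 ^ l.
    apply: leq_trans (leq_pmull _ _); last by rewrite expn_gt0.
    by rewrite -[1](expn0 3) ltn_exp2l.
  apply: (diam_nil_clean_Zn _ 3 1) => //.
    by rewrite dvdn_mull // dvdn_exp.
  move=> r e f re _.
  by apply: (nil_clean_Zn_pow 2 3 k l r (odd `|r|%N) e) => //; lia.
(* The exponent i = 0 serves clause (3), and i = 1 clause (4). *)
have case4 i p : prime p -> odd p ->
    is_diam (nil_clean_graph 'Z_(2 ^ i * p ^ 1)) (Some (p - 1)).
  move=> p_pr op; have n_gt1 : 1 < 2 ^ i * p ^ 1.
    apply: leq_trans (leq_pmull _ _); last by rewrite expn_gt0.
    by rewrite expn1 prime_gt1.
  apply: (diam_nil_clean_Zn _ p 1) => //.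
  - by rewrite dvdn_mull.
  - exact: coprimen1.
  - exact: prime_gt0.
  move=> r e f re _.
  apply: (nil_clean_Zn_pow 2 p i 1 r (odd `|r|%N) e) => //; last by lia.
  by rewrite coprime2n.
split; first by move=> k k_gt0 ->; apply: case1.
split; first by move=> k l l_gt0 ->; apply: case2.
split.
  move=> p p_pr; have [->|op] := even_prime p_pr; first exact: (case1 1).
  by have := case4 0 p p_pr op; rewrite mul1n expn1.
split; first by move=> p p_pr op ->; apply: (case4 1 p).
(* For p = 3 the moduli are not coprime, but n = 9 falls under clause (2). *)
move=> p p_pr op ->; have [->|p3] := eqVneq p 3; first exact: (case2 0 2).
have cp3 : coprime 3 p by rewrite prime_coprime // dvdn_prime2 // eq_sym.
apply: (diam_nil_clean_Zn _ p 3) => //.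
- by have := prime_gt0 p_pr; lia.
- exact: dvdn_mull.
- by rewrite coprime_sym.
- by rewrite odd_prime_gt2.
move=> r e f re rf; apply: (nil_clean_Zn_pow 3 p 1 1 r f e) => //.
by rewrite !expn1; have := prime_gt0 p_pr; lia.
Qed.
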